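(* Any locally algebraically cartesian closed category is algebraically coherent.
   Context: $\mathsf{Pt}_X(\mathcal{C})$ is the category of points over $X$: objects are triples $(A,\ p\colon A\to X,\ s\colon X\to A)$ with $ps=1_X$, and morphisms are morphisms between the objects $A$ commuting with the $p$'s and the $s$'s. For $f\colon X\to Y$, the change-of-base functor $f^*\colon \mathsf{Pt}_Y(\mathcal{C})\to\mathsf{Pt}_X(\mathcal{C})$ is pulling back along $f$. A finitely complete category $\mathcal{C}$ is locally algebraically cartesian closed if for every morphism $f\colon X\to Y$ in $\mathcal{C}$ the change-of-base functor $f^*\colon\mathsf{Pt}_Y(\mathcal{C})\to\mathsf{Pt}_X(\mathcal{C})$ is a left adjoint (i.e. has a right adjoint). A cospan $(f\colon X\to Z,\ g\colon Y\to Z)$ is jointly strongly epimorphic if for every monomorphism $m\colon M\to P$ and all morphisms $\phi\colon Z\to P$, $f'\colon X\to M$, $g'\colon Y\to M$ with $\phi f=mf'$ and $\phi g=mg'$ there is a unique $\varphi\colon Z\to M$ with $m\varphi=\phi$. (In a category with pullbacks this is equivalent to: every monomorphism into $Z$ through which both $f$ and $g$ factor is an isomorphism.) A functor between categories with finite limits is coherent if it preserves finite limits and jointly strongly epimorphic pairs. A category $\mathcal{C}$ with finite limits is algebraically coherent if $f^*$ is coherent for every morphism $f$ of $\mathcal{C}$. *)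

(* Defs.v *)
From Stdlib Require Import List FinFun ProofIrrelevance ClassicalEpsilon.

Set Implicit Arguments.
Unset Strict Implicit.
Unset Printing Implicit Defensive.

Declare Scope cat_scope.
Delimit Scope cat_scope with cat.
Local Open Scope cat_scope.

(** * Categories, functors, adjunctions *)

Record category := Category {
  ob :> Type;
  hom : ob -> ob -> Type;
  id : forall X, hom X X;
  comp : forall X Y Z, hom Y Z -> hom X Y -> hom X Z;
  comp_id_l : forall X Y (f : hom X Y), comp (id Y) f = f;
  comp_id_r : forall X Y (f : hom X Y), comp f (id X) = f;
  comp_assoc : forall W X Y Z (h : hom Y Z) (g : hom X Y) (f : hom W X),
    comp h (comp g f) = comp (comp h g) f
}.

Arguments hom {c} _ _.
Arguments id {c} _.
Arguments comp {c X Y Z} _ _.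

Notation "g ∘ f" := (comp g f) (at level 40, left associativity) : cat_scope.

Record functor (C D : category) := Functor {
  fobj :> C -> D;
  fmap : forall X Y : C, hom X Y -> hom (fobj X) (fobj Y);
  fmap_id : forall X : C, fmap (id X) = id (fobj X);
  fmap_comp : forall (X Y Z : C) (g : hom Y Z) (f : hom X Y),
    fmap (g ∘ f) = fmap g ∘ fmap f
}.

Arguments fmap {C D} _ {X Y} _.

Definition functor_comp (C D E : category) (G : functor D E) (F : functor C D) :
  functor C E.
Proof.
refine (@Functor C E (fun X => G (F X)) (fun X Y f => fmap G (fmap F f)) _ _).
- intros X. now rewrite !fmap_id.
- intros X Y Z g f. now rewrite !fmap_comp.
Defined.

Record adjunction (C D : category) (F : functor C D) (G : functor D C) :=
  Adjunction {
  adj_unit : forall X : C, hom X (G (F X));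
  adj_counit : forall Y : D, hom (F (G Y)) Y;
  adj_unit_natural : forall (X X' : C) (f : hom X X'),
    adj_unit X' ∘ f = fmap G (fmap F f) ∘ adj_unit X;
  adj_counit_natural : forall (Y Y' : D) (g : hom Y Y'),
    adj_counit Y' ∘ fmap F (fmap G g) = g ∘ adj_counit Y;
  triangle_left : forall X : C, adj_counit (F X) ∘ fmap F (adj_unit X) = id (F X);
  triangle_right : forall Y : D, fmap G (adj_counit Y) ∘ adj_unit (G Y) = id (G Y)
}.

Definition is_left_adjoint (C D : category) (F : functor C D) : Prop :=
  exists G : functor D C, inhabited (adjunction F G).

(** * Finite limits *)

Definition finite_category (J : category) : Prop :=
  Finite J /\ forall i j : J, Finite (hom i j).

Record cone (J C : category) (D : functor J C) := Cone {
  apex : C;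
  leg : forall j : J, hom apex (D j);
  leg_natural : forall (i j : J) (u : hom i j), fmap D u ∘ leg i = leg j
}.

Definition is_limit (J C : category) (D : functor J C) (c : cone D) : Prop :=
  forall c' : cone D,
    exists! u : hom (apex c') (apex c), forall j : J, leg c j ∘ u = leg c' j.

Definition finitely_complete (C : category) : Prop :=
  forall J : category, finite_category J ->
  forall D : functor J C, exists c : cone D, is_limit c.

Definition map_cone (J C D : category) (F : functor C D) (K : functor J C)
  (c : cone K) : cone (functor_comp F K).
Proof.
refine (@Cone J D (functor_comp F K) (F (apex c)) (fun j => fmap F (leg c j)) _).
intros i j u. simpl. now rewrite <- fmap_comp, leg_natural.
Defined.

Definition preserves_finite_limits (C D : category) (F : functor C D) : Prop :=
  forall J : category, finite_category J ->
  forall (K : functor J C) (c : cone K), is_limit c -> is_limit (map_cone F c).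

(** * Coherent functors *)

Definition mono (C : category) (M P : C) (m : hom M P) : Prop :=
  forall (T : C) (a b : hom T M), m ∘ a = m ∘ b -> a = b.

Definition jointly_strongly_epic (C : category) (X Y Z : C)
  (f : hom X Z) (g : hom Y Z) : Prop :=
  forall (M P : C) (m : hom M P), mono m ->
  forall (phi : hom Z P) (f' : hom X M) (g' : hom Y M),
    phi ∘ f = m ∘ f' -> phi ∘ g = m ∘ g' ->
    exists! psi : hom Z M, m ∘ psi = phi.

Definition preserves_jointly_strongly_epic (C D : category) (F : functor C D) :
  Prop :=
  forall (X Y Z : C) (f : hom X Z) (g : hom Y Z),
    jointly_strongly_epic f g -> jointly_strongly_epic (fmap F f) (fmap F g).

(** Coherence is a notion for functors between categories with finite limits,
    whence the first two fields. *)
Record coherent (C D : category) (F : functor C D) : Prop := Coherent {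
  coherent_dom : finitely_complete C;
  coherent_cod : finitely_complete D;
  coherent_limits : preserves_finite_limits F;
  coherent_epic : preserves_jointly_strongly_epic F
}.

(** * Pullbacks *)

Record pullback (C : category) (X Y Z : C) (f : hom X Z) (g : hom Y Z) :=
  Pullback {
  pb_ob : C;
  pb_fst : hom pb_ob X;
  pb_snd : hom pb_ob Y;
  pb_comm : f ∘ pb_fst = g ∘ pb_snd;
  pb_univ : forall (T : C) (a : hom T X) (b : hom T Y), f ∘ a = g ∘ b ->
    exists! u : hom T pb_ob, pb_fst ∘ u = a /\ pb_snd ∘ u = b
}.

Section Mediating.
Variables (C : category) (X Y Z : C) (f : hom X Z) (g : hom Y Z).
Variable P : pullback f g.

Definition pb_pair (T : C) (a : hom T X) (b : hom T Y) (e : f ∘ a = g ∘ b) :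
  hom T (pb_ob P) :=
  proj1_sig (constructive_indefinite_description _ (pb_univ P e)).

Lemma pb_fst_pair (T : C) (a : hom T X) (b : hom T Y) (e : f ∘ a = g ∘ b) :
  pb_fst P ∘ pb_pair e = a.
Proof.
unfold pb_pair.
destruct constructive_indefinite_description as [u [[H1 H2] H3]]; exact H1.
Qed.

Lemma pb_snd_pair (T : C) (a : hom T X) (b : hom T Y) (e : f ∘ a = g ∘ b) :
  pb_snd P ∘ pb_pair e = b.
Proof.
unfold pb_pair.
destruct constructive_indefinite_description as [u [[H1 H2] H3]]; exact H2.
Qed.

Lemma pb_ext (T : C) (u v : hom T (pb_ob P)) :
  pb_fst P ∘ u = pb_fst P ∘ v -> pb_snd P ∘ u = pb_snd P ∘ v -> u = v.
Proof.
intros H1 H2.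
assert (e : f ∘ (pb_fst P ∘ v) = g ∘ (pb_snd P ∘ v))
  by now rewrite !comp_assoc, pb_comm.
destruct (pb_univ P e) as [w [_ Hw]].
transitivity w; [symmetry|]; apply Hw; auto.
Qed.

End Mediating.

(** The walking cospan [WLeft --> WCenter <-- WRight], as a poset. *)

Inductive cospan_ob : Set := WLeft | WRight | WCenter.

Definition cospan_le (i j : cospan_ob) : bool :=
  match i, j with
  | WLeft, WLeft | WRight, WRight | _, WCenter => true
  | _, _ => false
  end.

Lemma cospan_le_refl (i : cospan_ob) : cospan_le i i = true.
Proof. now destruct i. Qed.

Lemma cospan_le_trans (i j k : cospan_ob) :
  cospan_le j k = true -> cospan_le i j = true -> cospan_le i k = true.
Proof. destruct i, j, k; simpl; congruence. Qed.

Definition walking_cospan : category.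
Proof.
refine (@Category cospan_ob (fun i j => cospan_le i j = true)
          cospan_le_refl cospan_le_trans _ _ _);
  intros; apply proof_irrelevance.
Defined.

Lemma walking_cospan_finite : finite_category walking_cospan.
Proof.
split.
- exists (WLeft :: WRight :: WCenter :: nil). intros []; simpl; auto.
- intros i j. simpl. destruct (cospan_le i j).
  + exists (eq_refl :: nil). intros e. left. apply proof_irrelevance.
  + exists nil. intros e. discriminate.
Qed.

Section CospanDiagram.
Variables (C : category) (X Y Z : C) (f : hom X Z) (g : hom Y Z).

Definition cospan_fobj (i : walking_cospan) : C :=
  match i with WLeft => X | WRight => Y | WCenter => Z end.

Definition cospan_fmap (i j : walking_cospan) :
  hom i j -> hom (cospan_fobj i) (cospan_fobj j).
Proof.
destruct i, j; intros e.
- exact (id X).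
- discriminate e.
- exact f.
- discriminate e.
- exact (id Y).
- exact g.
- discriminate e.
- discriminate e.
- exact (id Z).
Defined.

Definition cospan_diagram : functor walking_cospan C.
Proof.
refine (@Functor walking_cospan C cospan_fobj cospan_fmap _ _).
- intros []; reflexivity.
- intros [] [] [] v u; try discriminate u; try discriminate v; simpl;
    now rewrite ?comp_id_l, ?comp_id_r.
Defined.

Definition cospan_cone (T : C) (a : hom T X) (b : hom T Y) (e : f ∘ a = g ∘ b) :
  cone cospan_diagram.
Proof.
refine (@Cone walking_cospan C cospan_diagram T
  (fun i => match i return hom T (cospan_fobj i) with
            | WLeft => a | WRight => b | WCenter => f ∘ a end) _).
intros [] [] u; try discriminate u; simpl; now rewrite ?comp_id_l.
Defined.

Lemma pullback_exists : finitely_complete C -> inhabited (pullback f g).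
Proof.
intros HC.
destruct (HC _ walking_cospan_finite cospan_diagram) as [c Hc].
assert (HL := leg_natural c (i := WLeft) (j := WCenter) eq_refl).
assert (HR := leg_natural c (i := WRight) (j := WCenter) eq_refl).
simpl in HL, HR.
refine (inhabits (@Pullback C X Y Z f g (apex c)
  (leg c WLeft) (leg c WRight) (eq_trans HL (eq_sym HR)) _)).
intros T a b e. destruct (Hc (cospan_cone e)) as [u [Hu Huniq]].
exists u. split.
- split; [exact (Hu WLeft) | exact (Hu WRight)].
- intros v [H1 H2]. apply Huniq. intros []; simpl.
  + exact H1.
  + exact H2.
  + rewrite <- HL, <- H1. now rewrite comp_assoc.
Qed.

End CospanDiagram.

(** Another choice of pullbacks would give naturally isomorphic functors
    [change_of_base], hence the same notions below. *)
Definition chosen_pullback (C : category) (HC : finitely_complete C) (X Y Z : C)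
  (f : hom X Z) (g : hom Y Z) : pullback f g :=
  epsilon (pullback_exists f g HC) (fun _ => True).

(** * Categories of points *)

Section Points.
Variables (C : category) (X : C).

Record point := Point {
  pt_ob : C;
  pt_p : hom pt_ob X;
  pt_s : hom X pt_ob;
  pt_ps : pt_p ∘ pt_s = id X
}.

Record point_hom (A B : point) := PointHom {
  pt_map : hom (pt_ob A) (pt_ob B);
  pt_map_p : pt_p B ∘ pt_map = pt_p A;
  pt_map_s : pt_map ∘ pt_s A = pt_s B
}.

Lemma point_hom_eq (A B : point) (u v : point_hom A B) :
  pt_map u = pt_map v -> u = v.
Proof.
destruct u as [u u1 u2], v as [v v1 v2]; simpl; intros <-.
f_equal; apply proof_irrelevance.
Qed.

Definition point_id (A : point) : point_hom A A :=
  PointHom (comp_id_r (pt_p A)) (comp_id_l (pt_s A)).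

Definition point_comp (A B D : point) (v : point_hom B D) (u : point_hom A B) :
  point_hom A D.
Proof.
refine (@PointHom A D (pt_map v ∘ pt_map u) _ _).
- now rewrite comp_assoc, !pt_map_p.
- now rewrite <- comp_assoc, !pt_map_s.
Defined.

Definition Pt : category.
Proof.
refine (@Category point point_hom point_id point_comp _ _ _);
  intros; apply point_hom_eq; simpl.
- apply comp_id_l.
- apply comp_id_r.
- apply comp_assoc.
Defined.

End Points.

Section ChangeOfBase.
Variables (C : category) (HC : finitely_complete C) (X Y : C) (f : hom X Y).

Let P (A : Pt Y) : pullback f (pt_p A) := chosen_pullback HC f (pt_p A).

Lemma base_section_comm (A : Pt Y) : f ∘ id X = pt_p A ∘ (pt_s A ∘ f).
Proof. now rewrite comp_assoc, pt_ps, comp_id_l, comp_id_r. Qed.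

Definition base_ob (A : Pt Y) : Pt X :=
  Point (pb_fst_pair (P A) (base_section_comm A)).

Lemma base_map_comm (A B : Pt Y) (u : hom A B) :
  f ∘ pb_fst (P A) = pt_p B ∘ (pt_map u ∘ pb_snd (P A)).
Proof. now rewrite comp_assoc, pt_map_p, pb_comm. Qed.

Definition base_map (A B : Pt Y) (u : hom A B) : hom (base_ob A) (base_ob B).
Proof.
refine (@PointHom C X (base_ob A) (base_ob B)
          (pb_pair (P B) (base_map_comm u)) _ _); simpl.
- apply pb_fst_pair.
- apply pb_ext; rewrite comp_assoc.
  + now rewrite !pb_fst_pair.
  + rewrite !pb_snd_pair, <- comp_assoc, pb_snd_pair.
    now rewrite comp_assoc, pt_map_s.
Defined.

Definition change_of_base : functor (Pt Y) (Pt X).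
Proof.
refine (@Functor (Pt Y) (Pt X) base_ob base_map _ _).
- intros A. apply point_hom_eq; simpl. apply pb_ext.
  + now rewrite pb_fst_pair, comp_id_r.
  + rewrite pb_snd_pair, comp_id_r. apply comp_id_l.
- intros A B D v u. apply point_hom_eq; simpl. apply pb_ext.
  + now rewrite comp_assoc, !pb_fst_pair.
  + rewrite pb_snd_pair, comp_assoc, pb_snd_pair. simpl.
    rewrite <- !comp_assoc. now rewrite pb_snd_pair.
Defined.

End ChangeOfBase.

Definition locally_algebraically_cartesian_closed (C : category)
  (HC : finitely_complete C) : Prop :=
  forall (X Y : C) (f : hom X Y), is_left_adjoint (change_of_base HC f).

Definition algebraically_coherent (C : category) (HC : finitely_complete C) :
  Prop :=
  forall (X Y : C) (f : hom X Y), coherent (change_of_base HC f).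

(* Main.v *)
Require Import Defs.
From Stdlib Require Import List.

(** Two independent facts make up the theorem.

    A left adjoint [F] with right adjoint [G] preserves jointly strongly
    epimorphic pairs: a lifting problem for [(F f, F g)] against a monomorphism
    [m] transposes to a lifting problem for [(f, g)] against [G m], which is
    again a monomorphism (lemma [left_adjoint_preserves_jointly_strongly_epic]).
    This is the only place where local algebraic cartesian closedness enters.

    Moreover [f^*] is a functor between finitely complete categories and
    preserves finite limits, for every [f] in a finitely complete category.
    A limit of points over [X] is a limit in the slice over [X], that is, a
    limit in [C] of the diagram extended by [X] as a terminal vertex; its section
    is the map induced by the given sections ([fibred_limit_exists]). The
    predicate [fibred_limit] states this slice-level universal property, in which
    the test objects are arbitrary maps into the base and carry no section.
    Limits of points satisfy it ([limit_is_fibred]), and it is stable under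
    pulling back ([change_of_base_fibred_limit]), since a map into the
    pullback of [L] along [f] amounts to a map into [L] once its component in
    [X] is fixed. *)

Set Implicit Arguments.
Unset Strict Implicit.
Unset Printing Implicit Defensive.

Local Open Scope cat_scope.

(** * Left adjoints and jointly strongly epimorphic pairs *)

Section Adjoints.
Variables (C D : category) (F : functor C D) (G : functor D C).
Variable adj : adjunction F G.

Definition transpose (A : C) (B : D) (h : hom (F A) B) : hom A (G B) :=
  fmap G h ∘ adj_unit adj A.

Definition untranspose (A : C) (B : D) (k : hom A (G B)) : hom (F A) B :=
  adj_counit adj B ∘ fmap F k.

Lemma transposeK (A : C) (B : D) (h : hom (F A) B) :
  untranspose (transpose h) = h.
Proof.
unfold untranspose, transpose.
now rewrite fmap_comp, comp_assoc, adj_counit_natural, <- comp_assoc,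
  triangle_left, comp_id_r.
Qed.

Lemma untransposeK (A : C) (B : D) (k : hom A (G B)) :
  transpose (untranspose k) = k.
Proof.
unfold untranspose, transpose.
now rewrite fmap_comp, <- comp_assoc, <- adj_unit_natural, comp_assoc,
  triangle_right, comp_id_l.
Qed.

Lemma transpose_comp_l (A : C) (B B' : D) (m : hom B B') (h : hom (F A) B) :
  transpose (m ∘ h) = fmap G m ∘ transpose h.
Proof. unfold transpose. now rewrite fmap_comp, comp_assoc. Qed.

Lemma transpose_comp_r (A A' : C) (B : D) (h : hom (F A) B) (f : hom A' A) :
  transpose (h ∘ fmap F f) = transpose h ∘ f.
Proof.
unfold transpose.
now rewrite fmap_comp, <- !comp_assoc, adj_unit_natural.
Qed.

Lemma untranspose_comp_l (A : C) (B B' : D) (m : hom B B') (k : hom A (G B)) :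
  untranspose (fmap G m ∘ k) = m ∘ untranspose k.
Proof.
unfold untranspose.
now rewrite fmap_comp, comp_assoc, adj_counit_natural, comp_assoc.
Qed.

Lemma right_adjoint_mono (M P : D) (m : hom M P) : mono m -> mono (fmap G m).
Proof.
intros Hm T a b e.
rewrite <- (untransposeK a), <- (untransposeK b). f_equal.
apply Hm. now rewrite <- !untranspose_comp_l, e.
Qed.

(** Lifting problems transpose along the adjunction, so their solutions do. *)
Lemma left_adjoint_preserves_jointly_strongly_epic :
  preserves_jointly_strongly_epic F.
Proof.
intros X Y Z f g Hfg M P m Hm phi f' g' ef eg.
destruct (Hfg _ _ _ (right_adjoint_mono Hm) (transpose phi)
            (transpose f') (transpose g')) as [psi [Hpsi _]].
- now rewrite <- transpose_comp_r, <- transpose_comp_l, ef.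
- now rewrite <- transpose_comp_r, <- transpose_comp_l, eg.
- assert (e : m ∘ untranspose psi = phi)
    by now rewrite <- untranspose_comp_l, Hpsi, transposeK.
  exists (untranspose psi). split; [exact e|].
  intros k Hk. apply Hm. now rewrite e, Hk.
Qed.

End Adjoints.

(** * Adjoining a terminal vertex to a diagram shape *)

Section AddTerminal.
Variable J : category.

Definition terminal_hom (i j : option J) : Type :=
  match i, j with
  | Some i, Some j => hom i j
  | None, Some _ => Empty_set
  | _, None => unit
  end.

Definition terminal_id (i : option J) : terminal_hom i i :=
  match i with Some i => id i | None => tt end.

Definition terminal_comp (i j k : option J) :
  terminal_hom j k -> terminal_hom i j -> terminal_hom i k.
Proof.
destruct i as [i|], j as [j|], k as [k|]; simpl; intros v u;
  first [exact (v ∘ u) | exact tt | solve [destruct u] | solve [destruct v]].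
Defined.

Definition add_terminal : category.
Proof.
refine (@Category (option J) terminal_hom terminal_id terminal_comp _ _ _).
- intros [i|] [j|] u; simpl in *; try destruct u; auto using comp_id_l.
- intros [i|] [j|] u; simpl in *; try destruct u; auto using comp_id_r.
- intros [i|] [j|] [k|] [l|] w v u; simpl in *;
    try destruct u; try destruct v; try destruct w; auto using comp_assoc.
Defined.

Lemma add_terminal_finite : finite_category J -> finite_category add_terminal.
Proof.
intros [[l Hl] Hhom]. split.
- exists (None :: map Some l).
  intros [j|]; simpl; [right; apply in_map, Hl | now left].
- intros [i|] [j|].
  + exact (Hhom i j).
  + exists (tt :: nil). intros []. now left.
  + exists nil. intros [].
  + exists (tt :: nil). intros []. now left.
Qed.

End AddTerminal.

(** * Limits of points *)

Section FibredLimits.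
Variables (C : category) (X : C) (J : category) (K : functor J (Pt X)).

(** These are the cones over [K] in the slice category over [X], with apex [t]. *)
Definition slice_cone (T : C) (t : hom T X)
  (a : forall j : J, hom T (pt_ob (K j))) : Prop :=
  (forall j, pt_p (K j) ∘ a j = t) /\
  (forall (i j : J) (u : hom i j), pt_map (fmap K u) ∘ a i = a j).

Definition slice_mediating (c : cone K) (T : C) (t : hom T X)
  (a : forall j : J, hom T (pt_ob (K j))) (u : hom T (pt_ob (apex c))) : Prop :=
  pt_p (apex c) ∘ u = t /\ forall j, pt_map (leg c j) ∘ u = a j.

Definition fibred_limit (c : cone K) : Prop :=
  forall (T : C) (t : hom T X) (a : forall j : J, hom T (pt_ob (K j))),
    slice_cone t a -> exists! u : hom T (pt_ob (apex c)), slice_mediating t a u.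

Lemma cone_slice_cone (c : cone K) :
  slice_cone (pt_p (apex c)) (fun j => pt_map (leg c j)).
Proof.
split.
- intros j. apply pt_map_p.
- intros i j u. exact (f_equal (@pt_map _ _ _ _) (leg_natural c u)).
Qed.

Lemma slice_cone_comp (S T : C) (t : hom T X)
  (a : forall j : J, hom T (pt_ob (K j))) (h : hom S T) :
  slice_cone t a -> slice_cone (t ∘ h) (fun j => a j ∘ h).
Proof.
intros [Hp Hn]; split; intros; rewrite comp_assoc; f_equal; auto.
Qed.

Lemma fibred_limit_ext (c : cone K) (T : C) (u v : hom T (pt_ob (apex c))) :
  fibred_limit c ->
  pt_p (apex c) ∘ u = pt_p (apex c) ∘ v ->
  (forall j, pt_map (leg c j) ∘ u = pt_map (leg c j) ∘ v) -> u = v.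
Proof.
intros Hc ep el.
destruct (Hc _ _ _ (slice_cone_comp v (cone_slice_cone c))) as [w [_ Hw]].
transitivity w; [symmetry|]; apply Hw; split; auto.
Qed.

(** The mediating map of the slice automatically preserves sections, because
    both sections are compatible with the legs. *)
Lemma fibred_limit_is_limit (c : cone K) : fibred_limit c -> is_limit c.
Proof.
intros Hc c'.
destruct (Hc _ _ _ (cone_slice_cone c')) as [u [[Hup Hul] Huniq]].
assert (Hus : u ∘ pt_s (apex c') = pt_s (apex c)).
{ apply (fibred_limit_ext Hc).
  - now rewrite comp_assoc, Hup, !pt_ps.
  - intros j. now rewrite comp_assoc, Hul, !pt_map_s. }
exists (PointHom Hup Hus). split.
- intros j. now apply point_hom_eq.
- intros v Hv. apply point_hom_eq. apply Huniq. split.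
  + apply pt_map_p.
  + intros j. exact (f_equal (@pt_map _ _ _ _) (Hv j)).
Qed.

Definition extended_fobj (i : add_terminal J) : C :=
  match i with Some j => pt_ob (K j) | None => X end.

Definition extended_fmap (i j : add_terminal J) :
  hom i j -> hom (extended_fobj i) (extended_fobj j).
Proof.
destruct i as [i|], j as [j|]; intros u.
- exact (pt_map (fmap K u)).
- exact (pt_p (K i)).
- destruct u.
- exact (id X).
Defined.

Definition extended_diagram : functor (add_terminal J) C.
Proof.
refine (@Functor (add_terminal J) C extended_fobj extended_fmap _ _).
- intros [j|]; [|reflexivity]. exact (f_equal (@pt_map _ _ _ _) (fmap_id K j)).
- intros [i|] [j|] [k|] v u; try destruct u; try destruct v; simpl.
  + exact (f_equal (@pt_map _ _ _ _) (fmap_comp K v u)).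
  + symmetry. apply pt_map_p.
  + now rewrite comp_id_l.
  + now rewrite comp_id_l.
Defined.

Definition extended_cone (T : C) (t : hom T X)
  (a : forall j : J, hom T (pt_ob (K j))) (H : slice_cone t a) :
  cone extended_diagram.
Proof.
refine (@Cone (add_terminal J) C extended_diagram T
  (fun i => match i return hom T (extended_fobj i) with
            | Some j => a j | None => t end) _).
destruct H as [Hp Hn].
intros [i|] [j|] u; simpl; [apply Hn | apply Hp | destruct u | apply comp_id_l].
Defined.

(** The leg at the terminal vertex of a limit of the extended diagram is the
    projection of a point, and the sections of the points [K j] induce its
    section. For empty [J] this gives [X] itself, the zero object of [Pt X]. *)
Lemma fibred_limit_exists :
  finitely_complete C -> finite_category J -> exists c : cone K, fibred_limit c.
Proof.
intros HC HJ.
destruct (HC _ (add_terminal_finite HJ) extended_diagram) as [L HL].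
assert (Hs : slice_cone (id X) (fun j => pt_s (K j))).
{ split; intros; [apply pt_ps | apply pt_map_s]. }
destruct (HL (extended_cone Hs)) as [s [Hleg _]].
pose (A := Point (Hleg None)).
pose (l := fun j : J => @PointHom C X A (K j) (leg L (Some j))
  (leg_natural L (i := Some j) (j := None) tt) (Hleg (Some j))).
assert (Hl : forall (i j : J) (u : hom i j), fmap K u ∘ l i = l j).
{ intros i j u. apply point_hom_eq.
  exact (leg_natural L (i := Some i) (j := Some j) u). }
exists (@Cone J (Pt X) K A l Hl).
intros T t a H.
destruct (HL (extended_cone H)) as [u [Hu Huniq]].
exists u. split.
- split; [exact (Hu None) | exact (fun j => Hu (Some j))].
- intros v [Hvp Hvl]. apply Huniq. intros [j|]; [apply Hvl | exact Hvp].
Qed.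

(** The universal property of a limit of points quantifies over split test
    objects only. The wider one comes by comparing it with the limit built in
    [C], of which it is a retract over the legs. *)
Lemma limit_is_fibred (c : cone K) :
  finitely_complete C -> finite_category J -> is_limit c -> fibred_limit c.
Proof.
intros HC HJ Hc.
destruct (fibred_limit_exists HC HJ) as [c0 Hc0].
destruct (fibred_limit_is_limit Hc0 c) as [r [Hr _]].
destruct (Hc c0) as [q [Hq _]].
assert (Hqr : q ∘ r = id (apex c)).
{ destruct (Hc c) as [w [_ Hw]]. transitivity w; [symmetry|]; apply Hw.
  - intros j. now rewrite comp_assoc, Hq, Hr.
  - intros j. apply comp_id_r. }
assert (Hr' : forall j, pt_map (leg c0 j) ∘ pt_map r = pt_map (leg c j))
  by (intros j; exact (f_equal (@pt_map _ _ _ _) (Hr j))).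
assert (Hq' : forall j, pt_map (leg c j) ∘ pt_map q = pt_map (leg c0 j))
  by (intros j; exact (f_equal (@pt_map _ _ _ _) (Hq j))).
assert (Hqr' : pt_map q ∘ pt_map r = id (pt_ob (apex c)))
  by exact (f_equal (@pt_map _ _ _ _) Hqr).
intros T t a H.
destruct (Hc0 T t a H) as [w [[Hwp Hwl] Huniq]].
exists (pt_map q ∘ w). split.
- split.
  + now rewrite comp_assoc, pt_map_p.
  + intros j. now rewrite comp_assoc, Hq'.
- intros x [Hxp Hxl].
  rewrite (Huniq (pt_map r ∘ x)).
  + now rewrite comp_assoc, Hqr', comp_id_l.
  + split.
    * now rewrite comp_assoc, pt_map_p.
    * intros j. now rewrite comp_assoc, Hr'.
Qed.

End FibredLimits.

Lemma Pt_finitely_complete (C : category) (HC : finitely_complete C) (X : C) :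
  finitely_complete (Pt X).
Proof.
intros J HJ K.
destruct (fibred_limit_exists K HC HJ) as [c Hc].
exists c. now apply fibred_limit_is_limit.
Qed.

(** * Change of base preserves finite limits *)

Section ChangeOfBaseLimits.
Variables (C : category) (HC : finitely_complete C) (X Y : C) (f : hom X Y).

Let P (A : Pt Y) : pullback f (pt_p A) := chosen_pullback HC f (pt_p A).

Lemma base_map_snd (A B : Pt Y) (u : hom A B) :
  pb_snd (P B) ∘ pt_map (fmap (change_of_base HC f) u)
  = pt_map u ∘ pb_snd (P A).
Proof. apply pb_snd_pair. Qed.

(** A cone over [f^* K] with projection [t] in the slice over [X] corresponds,
    by composing with the projections of the pullbacks, to a cone over [K] with
    projection [f ∘ t] in the slice over [Y]. *)
Lemma change_of_base_fibred_limit (J : category) (K : functor J (Pt Y))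
  (c : cone K) :
  fibred_limit c -> fibred_limit (map_cone (change_of_base HC f) c).
Proof.
intros Hc T t a [Hp Hn].
assert (H : slice_cone (K := K) (f ∘ t) (fun j => pb_snd (P (K j)) ∘ a j)).
{ split.
  - intros j. rewrite comp_assoc, <- pb_comm, <- comp_assoc.
    f_equal. apply Hp.
  - intros i j u. rewrite comp_assoc, <- base_map_snd, <- comp_assoc.
    f_equal. apply Hn. }
destruct (Hc _ _ _ H) as [w [[Hwp Hwl] Huniq]].
exists (pb_pair (P (apex c)) (eq_sym Hwp)). split.
- split.
  + apply pb_fst_pair.
  + intros j. apply (pb_ext (P := P (K j))).
    * rewrite comp_assoc. etransitivity; [|symmetry; apply Hp].
      etransitivity; [|exact (pb_fst_pair (P (apex c)) (eq_sym Hwp))].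
      f_equal. exact (pt_map_p (fmap (change_of_base HC f) (leg c j))).
    * rewrite comp_assoc.
      etransitivity; [exact (f_equal (fun h => h ∘ _) (base_map_snd (leg c j)))|].
      now rewrite <- comp_assoc, pb_snd_pair.
- intros x [Hxp Hxl]. apply (pb_ext (P := P (apex c))).
  + rewrite pb_fst_pair. symmetry. exact Hxp.
  + rewrite pb_snd_pair. apply Huniq. split.
    * rewrite comp_assoc, <- pb_comm, <- comp_assoc. f_equal. exact Hxp.
    * intros j. rewrite comp_assoc, <- base_map_snd, <- comp_assoc.
      f_equal. apply Hxl.
Qed.

Lemma change_of_base_preserves_finite_limits :
  preserves_finite_limits (change_of_base HC f).
Proof.
intros J HJ K c Hc.
apply fibred_limit_is_limit, change_of_base_fibred_limit.
now apply limit_is_fibred.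
Qed.

End ChangeOfBaseLimits.

Theorem theorem4p5 (C : category) (HC : finitely_complete C) :
  locally_algebraically_cartesian_closed HC -> algebraically_coherent HC.
Proof.
intros Hlacc X Y f. destruct (Hlacc X Y f) as [G [adj]]. split.
- now apply Pt_finitely_complete.
- now apply Pt_finitely_complete.
- apply change_of_base_preserves_finite_limits.
- exact (left_adjoint_preserves_jointly_strongly_epic adj).
Qed.
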